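(* For any non-negative integers $n$ and $t$ and any $\mathbf{x}\in\{0,1\}^n$, $$\#\mathrm{iS}^{(t)}_{BA}(\mathbf{x})=\binom{n+2t}{t}.$$
   Context: A balanced adjacent insertion (BAI) inserts the two-bit word $01$ or $10$, as consecutive bits, at some position of a bit sequence (including the beginning and the end): $x_1\cdots x_n\mapsto x_1\cdots x_i\,b\bar b\,x_{i+1}\cdots x_n$ with $0\le i\le n$, $b\in\{0,1\}$, $\bar b=1-b$. $\mathrm{iS}_{BA}(\mathbf{x})$ is the set of all sequences obtained from $\mathbf{x}$ by a single BAI. Put $\mathrm{iS}^{(0)}_{BA}(\mathbf{x}):=\{\mathbf{x}\}$ and $\mathrm{iS}^{(t)}_{BA}(\mathbf{x}):=\bigcup_{\mathbf{y}\in\mathrm{iS}^{(t-1)}_{BA}(\mathbf{x})}\mathrm{iS}_{BA}(\mathbf{y})$ for $t\ge1$. *)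

(* Defs.v *)
From mathcomp Require Import all_boot.
From mathcomp Require Import finmap.

Set Implicit Arguments.
Unset Strict Implicit.
Unset Printing Implicit Defensive.

(* The bits 0 and 1 are the booleans false and true. *)
Definition insert_ba (x : seq bool) (i : nat) (b : bool) : seq bool :=
  take i x ++ [:: b; ~~ b] ++ drop i x.

Definition iSBA (x : seq bool) : {fset seq bool} :=
  [fset insert_ba x i b | i in iota 0 (size x).+1, b in [:: false; true]]%fset.

Fixpoint iSBAt (t : nat) (x : seq bool) : {fset seq bool} :=
  if t is t'.+1 then (\bigcup_(y <- iSBAt t' x) iSBA y)%fset
  else [fset x]%fset.

(* Main.v *)
Require Import Defs.
From mathcomp Require Import all_boot.
From mathcomp Require Import finmap.
From mathcomp Require Import zify.

(** Read a word [y] from left to right, keeping a stack of bits still to be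
produced, initially [x].  A letter equal to the top of the stack pops it; any
other letter [c] has to open an inserted pair, so its complement (which is the
top of the stack, if there is one) is pushed.  Then [y] is obtained from [x]
by [t] insertions iff the stack ends empty and [size y = size x + 2 * t].
Splitting on the first letter of [y] gives, for the number [f n t] of results,
[f n.+1 t.+1 = f n t.+1 + f n.+2 t] and [f 0 t.+1 = 2 * f 1 t], which is
Pascal's rule. *)

Definition residual (x : seq bool) (c : bool) : seq bool :=
  if x is a :: x' then if c == a then x' else a :: x else [:: ~~ c].

Definition absorbs (y x : seq bool) : bool := foldl residual x y == [::].

Lemma absorbs_cons c y x : absorbs (c :: y) x = absorbs y (residual x c).
Proof. by []. Qed.

Lemma absorbs_refl x : absorbs x x.
Proof. by elim: x => // a x IH; rewrite absorbs_cons /= eqxx. Qed.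

(** Each letter read shortens the stack by at most one. *)
Lemma absorbs_size y x : absorbs y x -> size x <= size y.
Proof.
elim: y x => [|c y IH] x; first by move/eqP => /= ->.
by rewrite absorbs_cons => /IH; case: x => [|a x] //=; case: eqP => //= _; lia.
Qed.

Lemma insert_ba0 x b : insert_ba x 0 b = b :: ~~ b :: x.
Proof. by rewrite /insert_ba take0 drop0. Qed.

Lemma insert_ba_nil i b : insert_ba [::] i b = [:: b; ~~ b].
Proof. by []. Qed.

Lemma insert_ba_cons c x i b : insert_ba (c :: x) i.+1 b = c :: insert_ba x i b.
Proof. by []. Qed.

Lemma size_insert_ba x i b : size (insert_ba x i b) = (size x).+2.
Proof. by rewrite /insert_ba !size_cat /= -[in RHS](cat_take_drop i x) size_cat; lia. Qed.

(** After one letter of [y] is read, the two stacks coincide or the longer still becomes the shorter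
    by deleting balanced pairs, so induction on [y] applies. *)
Lemma absorbs_insert_target y x i b : absorbs y (insert_ba x i b) -> absorbs y x.
Proof.
elim: y x i b => [|c y IH] x i b.
  by move=> /absorbs_size; rewrite size_insert_ba.
have IH0 b' x' : absorbs y [:: b', ~~ b' & x'] -> absorbs y x'.
  by rewrite -insert_ba0; apply: IH.
have IH1 a b' x' : absorbs y [:: a, b', ~~ b' & x'] -> absorbs y (a :: x').
  by rewrite -(insert_ba0 x') -insert_ba_cons; apply: IH.
rewrite !absorbs_cons; case: x i => [|a x] [|i].
- by rewrite insert_ba0 /=; case: c b => [] [] //= /IH1.
- by rewrite insert_ba_nil /=; case: c b => [] [] //= /IH1.
- rewrite insert_ba0; case: c b a => [] [] [] //=; try exact: IH0.
  (* Here [c = a] differs from [b]: pushing [b] creates two nested pairs, [b b ~~b ~~b] above [x']s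
     bits, deleted from the inside out. *)
  + by move=> /IH1; apply: IH0.
  + exact: IH1.
  + exact: IH1.
  + by move=> /IH1; apply: IH0.
- rewrite insert_ba_cons /=; case: eqP => _; first exact: IH.
  by rewrite -!insert_ba_cons; apply: IH.
Qed.

(** Reading [b] and then [~~ b] restores the stack, unless its top two bits are exactly [b], [~~ b];
    these are then lost, which [absorbs_insert_target] permits. *)
Lemma absorbs_insert_source y x i b : absorbs y x -> absorbs (insert_ba y i b) x.
Proof.
have ins0 z w : absorbs z w -> absorbs [:: b, ~~ b & z] w.
  rewrite !absorbs_cons; case: w => [|a w] /=; first by rewrite eqxx.
  case: (b =P a) => [->|/eqP ba].
    case: w => [|e w] /=; first by rewrite negbK.
    have [<-|ae] := eqVneq; last by rewrite (_ : e = a) //; case: a e ae => [] [].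
    by rewrite -insert_ba0; apply: absorbs_insert_target.
  by rewrite (_ : ~~ b = a) ?eqxx //; case: a b ba => [] [].
elim: i y x => [|i IH] [|c y] x; rewrite ?insert_ba0 ?insert_ba_nil.
- exact: ins0.
- exact: ins0.
- exact: ins0.
- by rewrite insert_ba_cons !absorbs_cons; apply: IH.
Qed.

Lemma iSBAP (x y : seq bool) :
  reflect (exists i b, i <= size x /\ y = insert_ba x i b) (y \in iSBA x).
Proof.
apply: (iffP (imfset2P _ _ _ _ _)) => [[i] /= + [b _ ->]|[i [b [ix ->]]]].
  by rewrite in_cons mem_iota => ix; exists i, b; split=> //; lia.
exists i; first by rewrite /= in_cons mem_iota; lia.
by exists b => //; rewrite /= !inE; case: b.
Qed.

Lemma iSBAtSP t (x y : seq bool) :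
  reflect (exists2 z, z \in iSBAt t x & y \in iSBA z) (y \in iSBAt t.+1 x).
Proof.
apply: (iffP (bigfcupP _ _ _ _)) => [[z]|[z zx yz]].
  by rewrite andbT; exists z.
by exists z; rewrite ?andbT.
Qed.

(** The recursion of [iSBAt] exposes the last insertion; reading from the left requires peeling off
    the first one. *)
Lemma iSBAt_step t (x z y : seq bool) :
  z \in iSBA x -> y \in iSBAt t z -> y \in iSBAt t.+1 x.
Proof.
move=> zx; elim: t y => [|t IH] y.
  by rewrite inE => /eqP->; apply/iSBAtSP; exists x; rewrite ?inE.
by move=> /iSBAtSP[w /IH wx yw]; apply/iSBAtSP; exists w.
Qed.

Lemma iSBAt_cons t c (x y : seq bool) :
  y \in iSBAt t x -> c :: y \in iSBAt t (c :: x).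
Proof.
elim: t y => [|t IH] y; first by rewrite !inE => /eqP->.
case/iSBAtSP => z /IH zx /iSBAP[i [b [iz ->]]].
by apply/iSBAtSP; exists (c :: z) => //; apply/iSBAP; exists i.+1, b.
Qed.

Lemma iSBAt_open t c (x y : seq bool) :
  y \in iSBAt t (~~ c :: x) -> c :: y \in iSBAt t.+1 x.
Proof.
move=> /(@iSBAt_cons _ c); apply: iSBAt_step.
by apply/iSBAP; exists 0, c; rewrite insert_ba0.
Qed.

(** Forwards, absorption survives every insertion into [y]. Backwards, each pop is an [iSBAt_cons]
    and each push an [iSBAt_open], which uses up one insertion. *)
Lemma mem_iSBAt t (x y : seq bool) :
  (y \in iSBAt t x) = absorbs y x && (size y == size x + 2 * t).
Proof.
apply/idP/andP => [|[]].
  elim: t y => [|t IH] y.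
    by rewrite inE muln0 addn0 => /eqP->; rewrite absorbs_refl.
  case/iSBAtSP => z /IH[zx /eqP sz] /iSBAP[i [b [_ ->]]].
  by rewrite absorbs_insert_source // size_insert_ba sz; split=> //; lia.
elim: y t x => [|c y IH] t x.
  by move=> /eqP /= -> /=; case: t => // _; apply: fset11.
rewrite absorbs_cons => yx /= st; have := absorbs_size _ _ yx.
case: x yx st => [|a x] /=.
  case: t => [|t] yx st _; first by lia.
  by apply: iSBAt_open; apply: IH => //=; lia.
case: eqP => [->|/eqP ca] yx st sxy.
  by apply: iSBAt_cons; apply: IH => //; lia.
(* With no insertion left, the pushed stack would be longer than the rest of [y]. *)
case: t st => [|t] st; first by move: sxy => /=; lia.
apply: iSBAt_open; apply: IH => /=; last by lia.
by rewrite (_ : ~~ c = a) //; case: c a ca {yx sxy} => [] [].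
Qed.

Lemma iSBAt_split t (x : seq bool) c (A B : {fset seq bool}) :
  (forall y, (c :: y \in iSBAt t x) = (y \in A)) ->
  (forall y, (~~ c :: y \in iSBAt t x) = (y \in B)) ->
  [::] \notin iSBAt t x -> #|` iSBAt t x| = #|` A| + #|` B|.
Proof.
move=> hA hB h0.
have -> : iSBAt t x =
    ([fset c :: y | y in A] `|` [fset ~~ c :: y | y in B])%fset.
  apply/fsetP => y; rewrite !inE; apply/idP/orP => [|[]].
  - case: y => [|d y]; first by rewrite (negbTE h0).
    have [->|dc] := eqVneq d c.
      by rewrite hA => yA; left; rewrite in_imfset.
    have -> : d = ~~ c by case: d c dc {hA hB} => [] [].
    by rewrite hB => yB; right; rewrite in_imfset.
  - by case/imfsetP => z /= zA ->; rewrite hA.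
  - by case/imfsetP => z /= zB ->; rewrite hB.
rewrite cardfsU [X in _ - #|` X|](_ : _ = fset0); last first.
  apply/fsetP => y; rewrite !inE; apply/negP => /andP[].
  by case/imfsetP => z _ -> /imfsetP[w _ [/esym]]; case: c {hA hB}.
by rewrite cardfs0 subn0 !card_imfset //= => u v [].
Qed.

Lemma card_iSBAt t (x : seq bool) : #|` iSBAt t x| = 'C(size x + 2 * t, t).
Proof.
elim: t x => [|t IHt] x; first by rewrite bin0 cardfs1.
have h0 w : [::] \notin iSBAt t.+1 w by rewrite mem_iSBAt /=; lia.
(* [IHt] covers all words, as needed for the longer stack [[:: a, a & x]]; [IHx] handles the pop at
   the same [t]. *)
elim: x => [|a x IHx].
  rewrite (@iSBAt_split _ _ true (iSBAt t [:: false]) (iSBAt t [:: true])) //.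
  - rewrite !IHt /= add0n (_ : 2 * t.+1 = (2 * t).+2); last by lia.
    (* Both letters push on the empty stack; the symmetry of row [2t+1] turns the doubled
       coefficient into a Pascal sum. *)
    rewrite binS -(@bin_sub (2 * t).+1 t.+1); last by lia.
    by rewrite (_ : (2 * t).+1 - t.+1 = t) ?add1n //; lia.
  - by move=> y; rewrite !mem_iSBAt absorbs_cons /=; congr andb; lia.
  - by move=> y; rewrite !mem_iSBAt absorbs_cons /=; congr andb; lia.
rewrite (@iSBAt_split _ _ a (iSBAt t.+1 x) (iSBAt t [:: a, a & x])) //.
- rewrite IHx IHt [size (a :: x)]/= addSn binS [size [:: a, a & x]]/=.
  by rewrite (_ : (size x).+2 + 2 * t = size x + 2 * t.+1) //; lia.
- by move=> y; rewrite !mem_iSBAt absorbs_cons /= eqxx; congr andb; lia.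
- move=> y; rewrite !mem_iSBAt absorbs_cons /= (_ : _ == a = false).
    by congr andb; lia.
  by case: a.
Qed.

Theorem theorem11p4 (n t : nat) (x : n.-tuple bool) :
  #|` iSBAt t x |%fset = 'C(n + 2 * t, t).
Proof. by rewrite card_iSBAt size_tuple. Qed.
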